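(* Let $C$ be a nonempty convex weakly compact subset of a uniformly nonsquare Banach space. Then every mapping $T:C\to C$ which satisfies condition $(C)$, and every continuous mapping $T:C\to C$ which satisfies condition $(C_\lambda)$ for some $\lambda\in(0,1)$, has a fixed point.
   Context: For $\lambda\in(0,1)$, a mapping $T:C\to X$ satisfies condition $(C_\lambda)$ if for all $x,y\in C$: $\lambda\|x-Tx\|\le\|x-y\|$ implies $\|Tx-Ty\|\le\|x-y\|$. Condition $(C)$ is condition $(C_{1/2})$. A Banach space $X$ with unit sphere $S_X$ is uniformly nonsquare if $J(X)=\sup_{x,y\in S_X}\min\{\|x+y\|,\|x-y\|\}<2$. *)

(* Defs.v *)
From HB Require Import structures.
From mathcomp Require Import all_boot all_order all_algebra.
From mathcomp Require Import all_classical all_reals all_analysis.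

Set Implicit Arguments.
Unset Strict Implicit.
Unset Printing Implicit Defensive.

Import Order.TTheory GRing.Theory Num.Theory.
Import numFieldTopology.Exports numFieldNormedType.Exports.

Local Open Scope classical_set_scope.
Local Open Scope ring_scope.

Definition topological_dual (R : realType) (X : normedModType R) : Type :=
  {f : {linear X -> R^o} | continuous f}.

Definition weak_topology (R : realType) (X : normedModType R) :
    topologicalType :=
  sup_topology (fun f : topological_dual X =>
    Topological.class (initial_topology (sval f : X -> R^o))).

Definition weakly_compact (R : realType) (X : normedModType R) (C : set X) :=
  compact (C : set (weak_topology X)).

Definition unit_sphere (R : realType) (X : normedModType R) : set X :=
  [set x | `|x| = 1].
Arguments unit_sphere {R} X.

(* The set below is bounded above by 2, so [sup] is the actual supremum unless
   X is the zero space, where the sphere is empty and [sup set0 = 0]. *)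
Definition james_constant (R : realType) (X : normedModType R) : R :=
  sup [set Num.min `|x + y| `|x - y| | x in unit_sphere X & y in unit_sphere X].

Definition uniformly_nonsquare (R : realType) (X : normedModType R) : Prop :=
  james_constant X < 2.

(* A mapping T : C -> X is represented by a total function of which only the
   values on C are used. *)
Definition condition_Clambda (R : realType) (X : normedModType R) (lambda : R)
    (C : set X) (T : X -> X) : Prop :=
  forall x y, C x -> C y ->
    lambda * `|x - T x| <= `|x - y| -> `|T x - T y| <= `|x - y|.

Definition condition_C (R : realType) (X : normedModType R)
    (C : set X) (T : X -> X) : Prop :=
  condition_Clambda 2^-1 C T.

(* Main.v *)
Require Import Defs.
From HB Require Import structures.
From mathcomp Require Import all_boot all_order all_algebra.
From mathcomp Require Import all_classical all_reals all_analysis.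
From mathcomp Require Import ring lra.

Set Implicit Arguments.
Unset Strict Implicit.
Unset Printing Implicit Defensive.

Import Order.TTheory GRing.Theory Num.Theory.
Import numFieldTopology.Exports numFieldNormedType.Exports.

Local Open Scope classical_set_scope.
Local Open Scope ring_scope.

(** The mappings considered here are nonexpansive between points that are far
    apart compared with their displacement, and the proof runs the classical
    minimal-set argument for nonexpansive mappings while applying T only to such
    pairs.

    Suppose that T has no fixed point, and let K be a minimal nonempty convex
    weakly closed T-invariant subset of C.  Iterating the averaged map
    (1 - lambda) I + lambda T makes the displacement |x - T x| tend to 0
    uniformly on K ([averaged_asymptotically_regular], from an inequality of
    Ishikawa), so K carries ultrafilters of approximate fixed points.  Along such
    an ultrafilter U the distance |x - u| tends to a limit c that is the same for
    all u in K ([approx_fixed_radius], a Goebel-Karlovitz lemma): the limit does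
    not increase under T and its sublevel sets are convex and weakly closed, so
    minimality makes each nonempty one equal to K.  The infimum c0 of these radii is
    positive.

    Choose U with c close to c0, let x0 be its weak limit, and apply many steps of
    the averaged map to x0 / 5 + 4 x / 5.  The resulting points z(x) are, along U,
    within about c / 5 of x and within about 4 c / 5 of one another
    ([shifted_orbit_estimates]), and being almost fixed they stay at distance
    almost c0 from x0, for otherwise there would be an ultrafilter of approximate
    fixed points with a radius below c0.  If z0 is the weak limit of the z(x),
    then p = z0 - x0 has norm about c / 5 at most, the y(x) = z(x) - z0 are weakly
    null with mutual distances about 4 c / 5 at most, and |p + y(x)| is almost c.
    A uniformly nonsquare space forbids this
    ([uniformly_nonsquare_weakly_null]): functionals norming p + y(i) and p + y(j)
    show that p and w = y(j) - y(i), once normalised, have both |p + w| and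
    |p - w| close to 2.

    Weak limits are taken along ultrafilters throughout.  A limit along an
    ultrafilter of functionals in the dual unit ball is again in the dual unit
    ball, which supplies the weak* limits and the subgradients of convex
    functions, so that norming functionals are the only consequence of
    Hahn-Banach involved.  The two halves of the theorem differ only in why a
    point approximated by approximate fixed points is fixed: by an inequality of
    Suzuki under condition (C), by continuity otherwise. *)

(** * Norming functionals *)

Section Norming.
Context {R : realType} {V : normedModType R}.
Implicit Types (p q f : V -> R) (x y v : V) (a t : R).

Definition sublinear p :=
  (forall x y, p (x + y) <= p x + p y) /\
  (forall a x, 0 <= a -> p (a *: x) <= a * p x).

(** The unit ball of the dual, with bare functions as elements so that pointwise
    limits can be formed directly. *)
Definition dual_ball f :=
  [/\ forall x y, f (x + y) = f x + f y,
      forall a x, f (a *: x) = a * f x &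
      forall x, f x <= `|x|].

Lemma sublinear0 p : sublinear p -> p 0 = 0.
Proof.
move=> [pD pZ]; apply/eqP; rewrite eq_le.
have := pZ 0 0 (lexx 0); rewrite scale0r mul0r => -> /=.
by have := pD 0 0; rewrite addr0 lerDl.
Qed.

Lemma sublinearZ p a x : sublinear p -> 0 <= a -> p (a *: x) = a * p x.
Proof.
move=> sp a0; have [_ pZ] := sp; apply/eqP; rewrite eq_le pZ //=.
have [->|an0] := eqVneq a 0; first by rewrite scale0r mul0r sublinear0.
have ap : 0 < a by rewrite lt_neqAle eq_sym an0.
have := pZ a^-1 (a *: x); rewrite invr_ge0 => /(_ a0).
by rewrite scalerA mulVf // scale1r mulrC ler_pdivlMr // mulrC.
Qed.

Lemma sublinear_lb p x : sublinear p -> - p (- x) <= p x.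
Proof.
move=> sp; have [pD _] := sp; have := pD x (- x).
by rewrite subrr sublinear0 // => h; lra.
Qed.

(** The largest sublinear functional below [p] whose value at [- v] is at most
    [- p v]: whatever is minimal among sublinear functionals must equal all its
    tilts, and this is what forces it to be linear. *)
Definition tilt p v x :=
  inf [set p (x + t *: v) - t * p v | t in [set t | 0 <= t]].

Lemma tilt_bound p v x t : sublinear p -> 0 <= t ->
  - p (- x) <= p (x + t *: v) - t * p v.
Proof.
move=> sp t0; have [pD _] := sp.
have := pD (x + t *: v) (- x); rewrite addrAC subrr add0r sublinearZ //; lra.
Qed.

Lemma tilt_le p v x t : sublinear p -> 0 <= t ->
  tilt p v x <= p (x + t *: v) - t * p v.
Proof.
move=> sp t0; apply: ge_inf; last by exists t.
by exists (- p (- x)) => _ [s s0 <-]; exact: tilt_bound.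
Qed.

Lemma le_tilt p v x c :
  (forall t, 0 <= t -> c <= p (x + t *: v) - t * p v) -> c <= tilt p v x.
Proof.
move=> h; apply: lb_le_inf => [|_ [t /= t0 <-]]; last exact: h.
by exists (p (x + 0 *: v) - 0 * p v); exists 0 => /=.
Qed.

Lemma tilt_ler p v x : sublinear p -> tilt p v x <= p x.
Proof.
by move=> /(tilt_le v x)/(_ (lexx 0)); rewrite scale0r addr0 mul0r subr0.
Qed.

Lemma tilt_opp p v : sublinear p -> tilt p v (- v) <= - p v.
Proof.
move=> sp; have := tilt_le v (- v) sp ler01.
by rewrite scale1r addNr sublinear0 // mul1r add0r.
Qed.

Lemma tilt_sublinear p v : sublinear p -> sublinear (tilt p v).
Proof.
move=> sp; have [pD pZ] := sp; split=> [x y|a x a0].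
  rewrite -lerBlDr; apply: le_tilt => t t0; rewrite lerBlDr -lerBlDl.
  apply: le_tilt => s s0; rewrite lerBlDl.
  apply: le_trans (tilt_le _ _ sp (addr_ge0 t0 s0)) _.
  have := pD (x + t *: v) (y + s *: v).
  by rewrite addrACA -scalerDl mulrDl; lra.
have [->|an0] := eqVneq a 0.
  rewrite scale0r mul0r; apply: le_trans (tilt_ler _ _ sp) _.
  by rewrite sublinear0.
have ap : 0 < a by rewrite lt_neqAle eq_sym an0.
rewrite mulrC -ler_pdivrMr //; apply: le_tilt => t t0.
rewrite ler_pdivrMr //.
apply: le_trans (tilt_le _ _ sp (mulr_ge0 a0 t0)) _.
by rewrite -scalerA -scalerDr sublinearZ // -mulrA -mulrBr mulrC.
Qed.

Lemma norm_sublinear : sublinear (fun x : V => `|x|).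
Proof.
by split=> [x y|a x a0]; [exact: ler_normD|rewrite normrZ ger0_norm].
Qed.

(** Zorn's lemma applies because the pointwise infimum of a chain is sublinear:
    subadditivity mixes two members of the chain, and the smaller one serves for
    both.  It is finite because any sublinear [r] below [p] satisfies
    [- p (- x) <= - r (- x) <= r x]. *)
Lemma minimal_sublinear p : sublinear p ->
  exists q, [/\ sublinear q, forall x, q x <= p x &
    forall r, sublinear r -> (forall x, r x <= q x) -> r = q].
Proof.
move=> sp.
pose P r := sublinear r /\ forall x, r x <= p x.
pose le (r s : {r | P r}) := `[< forall x, sval s x <= sval r x >].
have [||||[q [sq qp]] qmin] := @Zorn {r | P r} le.
- by move=> r; apply/asboolP.
- move=> r s t /asboolP rs /asboolP st; apply/asboolP => x.
  exact: le_trans (rs x).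
- move=> [r Pr] [s Ps] /asboolP/= rs /asboolP/= sr; apply/eq_exist/funext => x.
  by apply/eqP; rewrite eq_le rs sr.
- move=> A Atot.
  have [A0|[r0 Ar0]] : A = set0 \/ A !=set0.
    by case: (pselect (A = set0)) => [|/eqP/set0P]; [left|right].
    have Pp : P p by [].
    by exists (exist _ p Pp) => s; rewrite A0.
  pose q x := inf [set sval r x | r in A].
  have Alb x : has_lbound [set sval r x | r in A].
    exists (- p (- x)) => _ [[r [sr rp]] _ <-] /=.
    by apply: le_trans (sublinear_lb x sr); rewrite lerN2.
  have qle r x : A r -> q x <= sval r x.
    by move=> Ar; apply: ge_inf => //; exists r.
  have le_q x c : (forall r, A r -> c <= sval r x) -> c <= q x.
    move=> h; apply: lb_le_inf => [|_ [r Ar <-]]; last exact: h.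
    by exists (sval r0 x), r0.
  have Pq : P q.
    split; last first.
      by move=> x; apply: le_trans (qle _ _ Ar0) _; case: (r0) => r [].
    split=> [x y|a x a0].
      rewrite -lerBlDr; apply: (le_q) => r Ar; rewrite lerBlDr -lerBlDl.
      apply: (le_q) => s As; rewrite lerBlDl.
      have [/asboolP rs|/asboolP sr] := Atot _ _ Ar As.
        apply: le_trans (qle _ _ As) _.
        apply: le_trans (_ : sval s x + sval s y <= _); last by rewrite lerD2r.
        by case: (s) => s' Ps /=; case: Ps => [[sD _] _]; exact: sD.
      apply: le_trans (qle _ _ Ar) _.
      apply: le_trans (_ : sval r x + sval r y <= _); last by rewrite lerD2l.
      by case: (r) => r' Pr /=; case: Pr => [[rD _] _]; exact: rD.
    have [->|an0] := eqVneq a 0.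
      rewrite scale0r mul0r; apply: le_trans (qle _ _ Ar0) _.
      by case: (r0) => r Pr /=; case: Pr => sr _; rewrite sublinear0.
    have ap : 0 < a by rewrite lt_neqAle eq_sym an0.
    rewrite mulrC -ler_pdivrMr //; apply: (le_q) => r Ar.
    rewrite ler_pdivrMr // mulrC; apply: le_trans (qle _ _ Ar) _.
    by case: (r) => r' Pr /=; case: Pr => [[_ rZ] _]; exact: rZ.
  exists (exist _ q Pq) => r Ar; apply/asboolP => x /=; exact: qle.
exists q; split=> // r sr rq.
have Pr : P r by split=> // x; apply: le_trans (qp x).
have /(_ _)/(congr1 sval) := qmin (exist _ r Pr); apply; exact/asboolP.
Qed.

Lemma minimal_sublinear_linear p : sublinear p ->
  (forall r, sublinear r -> (forall x, r x <= p x) -> r = p) ->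
  (forall x y, p (x + y) = p x + p y) /\ (forall a x, p (a *: x) = a * p x).
Proof.
move=> sp pmin; have [pD pZ] := sp.
have pN x : p (- x) = - p x.
  apply/eqP; rewrite eq_le; apply/andP; split.
    rewrite -{1}(pmin (tilt p x) (tilt_sublinear x sp)) ?tilt_opp // => y.
    exact: tilt_ler.
  by have := sublinear_lb (- x) sp; rewrite opprK.
split=> [x y|a x].
  apply/eqP; rewrite eq_le pD /=.
  by have := pD (- x) (- y); rewrite -opprD !pN -opprD lerN2.
have [a0|a0] := leP 0 a; first exact: sublinearZ.
by rewrite -[a]opprK scaleNr pN sublinearZ ?mulNr // oppr_ge0 ltW.
Qed.

(** Hahn-Banach for one vector.  A minimal sublinear functional below the tilt of
    the norm along [v] is linear and at most [- `|v|] at [- v], so it attains the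
    norm at [v]. *)
Lemma exists_norming v : exists2 f, dual_ball f & f v = `|v|.
Proof.
have sN := norm_sublinear.
have [f [sf fN fmin]] := minimal_sublinear (tilt_sublinear v sN).
have [fD fZ] := minimal_sublinear_linear sf fmin.
have fle x : f x <= `|x| by apply: le_trans (fN x) _; exact: tilt_ler.
exists f; first by split.
apply/eqP; rewrite eq_le fle /=.
have := le_trans (fN (- v)) (tilt_opp v sN).
by rewrite -scaleN1r fZ mulN1r lerN2.
Qed.

Lemma dual_ballN f x : dual_ball f -> f (- x) = - f x.
Proof. by move=> [_ fZ _]; rewrite -scaleN1r fZ mulN1r. Qed.

Lemma dual_ballB f x y : dual_ball f -> f (x - y) = f x - f y.
Proof. by move=> df; have [fD _ _] := df; rewrite fD dual_ballN. Qed.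

Lemma dual_ball_norm f x : dual_ball f -> `|f x| <= `|x|.
Proof.
move=> df; have [_ _ fle] := df; rewrite ler_norml fle andbT.
by have := fle (- x); rewrite dual_ballN // normrN; lra.
Qed.

End Norming.

(** * Ultralimits and weak convergence *)

Lemma fmap_ultra (I J : Type) (h : I -> J) (U : set_system I) :
  UltraFilter U -> UltraFilter (h @ U).
Proof.
move=> UU; split; first exact: fmap_proper_filter.
move=> G GF UG; rewrite predeqE => A; split; last exact: UG.
move=> GA; have [//|UnA] := in_ultra_setVsetC (h @^-1` A) UU.
have GnA : G (~` A) by exact: UG.
by have /(@filter_ex _ G)[x []] : G (A `&` ~` A) by exact: filterI.
Qed.

Section Ultralimits.
Context {R : realType} {V : normedModType R} {I : Type} (U : set_system I).
Context {UU : UltraFilter U}.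
Implicit Types (f : I -> R) (z : I -> V) (M : R).

Lemma ultra_bounded_cvg f M : (\forall i \near U, `|f i| <= M) ->
  exists l : R, f i @[i --> U] --> l.
Proof.
move=> fM; have := @segment_compact R (- M) M; rewrite compact_ultra.
have UfU := fmap_ultra f UU.
move=> /(_ (f @ U) UfU) [|l [_ fl]]; last by exists l.
by apply: filterS fM => i; rewrite /= in_itv/= ler_norml.
Qed.

(** Weak* compactness of the dual ball in the form used below: the limit
    along an ultrafilter exists at every vector because the values at [x] are
    bounded by [`|x|], and it inherits linearity and the bound. *)
Lemma dual_ball_ultralimit (f : I -> V -> R) : (forall i, dual_ball (f i)) ->
  exists2 g, dual_ball g & forall x, f i x @[i --> U] --> g x.
Proof.
move=> df.
have /choice[g fg] : forall x, exists l : R, f i x @[i --> U] --> l.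
  move=> x; apply: (@ultra_bounded_cvg _ `|x|).
  by near=> i; exact: dual_ball_norm.
exists g => //; split=> [x y|a x|x].
- apply: (@cvg_unique _ _ _ _ _ _ (fg (x + y))) => //.
  rewrite (_ : (fun i => f i (x + y)) = (fun i => f i x + f i y)).
    exact: cvgD.
  by apply/funext => i; have [-> _ _] := df i.
- apply: (@cvg_unique _ _ _ _ _ _ (fg (a *: x))) => //.
  rewrite (_ : (fun i => f i (a *: x)) = (fun i => a * f i x)).
    by apply: cvgM => //; exact: cvg_cst.
  by apply/funext => i; have [_ -> _] := df i.
- apply: (cvgr_to_le (fg x)); near=> i; have [_ _] := df i; exact.
Unshelve. all: by end_near. Qed.

Definition weak_cvg z (z0 : V) :=
  forall f : V -> R, dual_ball f -> f (z i) @[i --> U] --> f z0.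

(** Weak lower semicontinuity of the norm, by testing against a functional that
    norms [z0 - u]. *)
Lemma weak_cvg_norm_le z (z0 u : V) (c : R) : weak_cvg z z0 ->
  (\forall i \near U, `|z i - u| <= c) -> `|z0 - u| <= c.
Proof.
move=> zz0 zc; have [f df <-] := exists_norming (z0 - u).
rewrite dual_ballB // lerBlDr; apply: (cvgr_to_le (zz0 f df)).
near=> i; rewrite -lerBlDr -dual_ballB //.
have [_ _ fle] := df; apply: le_trans (fle _) _.
by near: i.
Unshelve. all: by end_near. Qed.

End Ultralimits.

Section WeakCompactness.
Context {R : realType} {V : normedModType R}.
Implicit Types (C : set V).

Lemma dual_ball_continuous (f : V -> R) : dual_ball f -> continuous f.
Proof.
move=> df x; apply/cvgrPdist_le => /= e e0; near=> y.
rewrite -dual_ballB //; apply: le_trans (dual_ball_norm _ df) _.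
by near: y; exact: cvgr_dist_le.
Unshelve. all: by end_near. Qed.

Lemma dual_ball_dual (f : V -> R) : dual_ball f ->
  exists F : topological_dual V, forall x, sval F x = f x.
Proof.
move=> df; have [fD fZ _] := df.
have lf : linear (f : V -> R^o) by move=> a x y; rewrite fD fZ.
pose mf := GRing.isLinear.Build R V R^o *:%R (f : V -> R^o) lf.
pose F : {linear V -> R^o} := HB.pack (f : V -> R^o) mf.
have cF : continuous F by exact: dual_ball_continuous.
by exists (exist _ F cF).
Qed.

Lemma weakly_compact_ultra C : weakly_compact C ->
  forall (I : Type) (U : set_system I) (z : I -> V), UltraFilter U ->
    (\forall i \near U, C (z i)) -> exists2 z0, C z0 & weak_cvg U z z0.
Proof.
rewrite /weakly_compact compact_ultra => Cc I U z UU zC.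
have UzU := fmap_ultra z UU.
have [z0 [Cz0 zz0]] := Cc (z @ U) UzU zC.
exists z0 => // f df; have [F Ff] := dual_ball_dual df.
have /cvg_sup/(_ F) zF := zz0.
have := cvg_comp _ _ zF (@initial_continuous _ _ (sval F : V -> R^o) z0).
rewrite (_ : sval F = f :> (V -> R)); last exact/funext.
by [].
Qed.

End WeakCompactness.

(** * Weakly compact sets are bounded *)

Section Boundedness.
Context {R : realType} {V : normedModType R}.
Implicit Types (C : set V) (h : nat -> V -> R) (x : nat -> V).

(** The signs are chosen so that the step of size [2 / 3 ^ n.+1] at stage [n]
    cannot cancel what precedes it at [x n]. The step sizes telescope
    to total mass 1, and the steps after stage [n] add up to half of that
    step. *)
Fixpoint gliding_hump h x n (v : V) : R :=
  if n is m.+1 then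
    gliding_hump h x m v +
    (-1) ^+ (gliding_hump h x m (x m) < 0)%R * (2 * 3^-1 ^+ n) * h m v
  else 0.

Lemma gliding_hump_tail h x n m v : (forall k, dual_ball (h k)) ->
  `|gliding_hump h x (n + m) v - gliding_hump h x n v| <=
  (3^-1 ^+ n - 3^-1 ^+ (n + m)) * `|v|.
Proof.
move=> dh; elim: m => [|m IH]; first by rewrite addn0 !subrr normr0 mul0r.
rewrite addnS /= addrAC; apply: le_trans (ler_normD _ _) _.
rewrite !normrM normr_sign mul1r.
have q0 : 0 <= 3^-1 ^+ (n + m).+1 :> R by rewrite exprn_ge0.
rewrite (ger0_norm q0) [`|2|]ger0_norm //.
have := ler_wpM2l q0 (dual_ball_norm v (dh (n + m)%N)).
move: IH; rewrite exprS.
set a := gliding_hump _ _ _ _; set b := gliding_hump _ _ _ _.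
set c := _ ^+ (n + m); set d := `|h _ _|; set e := `|v|; nra.
Qed.

Lemma gliding_hump_dual_ball h x n : (forall k, dual_ball (h k)) ->
  dual_ball (gliding_hump h x n).
Proof.
move=> dh; split.
- elim: n => [|n IH] u v /=; first by rewrite addr0.
  by rewrite IH; have [-> _ _] := dh n; ring.
- elim: n => [|n IH] a v /=; first by rewrite mulr0.
  by rewrite IH; have [_ -> _] := dh n; ring.
- move=> v; have := gliding_hump_tail x 0 n v dh.
  rewrite add0n /= subr0 expr0 => /(le_trans (ler_norm _))/le_trans; apply.
  by rewrite ler_piMl // lerBlDr lerDl exprn_ge0.
Qed.

Lemma gliding_hump_big h x n : h n (x n) = `|x n| ->
  2 * 3^-1 ^+ n.+1 * `|x n| <= `|gliding_hump h x n.+1 (x n)|.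
Proof.
move=> hn /=; rewrite hn; set g := gliding_hump _ _ _ _.
have q0 : 0 <= 2 * 3^-1 ^+ n.+1 :> R by rewrite mulr_ge0 // exprn_ge0.
set a := 2 * _ in q0 *.
have ax0 : 0 <= a * `|x n| by exact: mulr_ge0.
case: ltP => g0; rewrite ?expr1 ?expr0 ?mulN1r ?mul1r ?mulNr.
  by rewrite ler0_norm; lra.
by rewrite ger0_norm; lra.
Qed.

(** Uniform boundedness by a gliding hump.  If the set were unbounded, it would
    contain [x n] with [`|x n| > n * 3 ^ n.+1], and the limit [f] of the sums of
    signed functionals norming these points would satisfy [`|f (x n)| >= n],
    whereas [f (x n)] converges along an ultrafilter by weak compactness. *)
Lemma weakly_compact_bounded C : weakly_compact C ->
  exists M : R, forall v, C v -> `|v| <= M.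
Proof.
move=> Cc; apply: contrapT => unb.
have /choice[x xP] (n : nat) : exists v, C v /\ n%:R * 3 ^+ n.+1 < `|v|.
  apply: contrapT => nv; apply: unb; exists (n%:R * 3 ^+ n.+1) => v Cv.
  by rewrite leNgt; apply/negP => vn; apply: nv; exists v.
have /choice[h hP] n : exists f : V -> R, dual_ball f /\ f (x n) = `|x n|.
  by have [f df fx] := exists_norming (x n); exists f.
have dh n : dual_ball (h n) by have [] := hP n.
have [U [UU Uoo]] := ultraFilterLemma eventually_filter.
have xC : \forall n \near U, C (x n) by apply: filterE => n; have [] := xP n.
have [z0 _ xz0] := weakly_compact_ultra Cc UU xC.
have [f df Ff] := dual_ball_ultralimit (U := U)
  (fun n => gliding_hump_dual_ball x n dh).
have fx n : n%:R <= `|f (x n)|.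
  have fF : `|f (x n) - gliding_hump h x n.+1 (x n)| <= 3^-1 ^+ n.+1 * `|x n|.
    apply: (cvgr_to_le (cvg_norm (cvgB (Ff (x n)) (cvg_cst _)))).
    apply: Uoo; exists n.+1 => // m /= nm.
    rewrite -(subnKC nm); apply: le_trans (gliding_hump_tail _ _ _ _ dh) _.
    by rewrite ler_wpM2r // lerBlDr lerDl exprn_ge0.
  have := gliding_hump_big (proj2 (hP n)).
  have : n%:R <= 3^-1 ^+ n.+1 * `|x n|.
    by rewrite exprVn mulrC ler_pdivlMr ?exprn_gt0 // ltW // (proj2 (xP n)).
  have := lerB_dist (gliding_hump h x n.+1 (x n)) (f (x n)).
  move: fF; rewrite distrC; lra.
have /cvgr_norm_le : f (x n) @[n --> U] --> f z0 by exact: xz0.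
move=> /(_ (`|f z0| + 1)); rewrite ltrDl => /(_ ltr01) fle.
have Ubig : U [set n | `|f z0| + 1 < n%:R].
  apply: Uoo; have [k _ kP] := nbhs_infty_gtr (`|f z0| + 1).
  by exists k.
have [n [/= n1 n2]] := filter_ex (filterI fle Ubig).
by have := fx n; lra.
Qed.

End Boundedness.

(** * Weakly null families in uniformly nonsquare spaces *)

Section Nonsquare.
Context {R : realType} {V : normedModType R}.
Implicit Types (f g : V -> R) (p w u v : V).

Lemma james_constant_ge u v : `|u| = 1 -> `|v| = 1 ->
  Num.min `|u + v| `|u - v| <= james_constant V.
Proof.
move=> u1 v1; apply: ub_le_sup; last by exists u => //; exists v.
exists 2 => _ [a a1 [b b1 <-]]; rewrite ge_min; apply/orP; left.
by apply: le_trans (ler_normD _ _) _; rewrite a1 b1.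
Qed.

(** Two functionals that agree in sign on [p] and disagree on [w], both almost
    attaining the norms there, witness that the normalised sum and difference of
    [p] and [w] are both almost of norm 2. *)
Lemma james_constant_functionals f g p w (a b e : R) :
  dual_ball f -> dual_ball g -> 0 < a -> 0 < b -> e < 1 ->
  `|p| <= a -> `|w| <= b ->
  (1 - e) * a <= f p -> (1 - e) * b <= f w ->
  (1 - e) * a <= g p -> g w <= - ((1 - e) * b) ->
  2 * (1 - e) <= james_constant V.
Proof.
move=> df dg a0 b0 e1 pa wb fp fw gp gw.
have e0 : 0 < 1 - e by rewrite subr_gt0.
have normalize (F : V -> R) q (c : R) : dual_ball F -> 0 < c -> `|q| <= c ->
    (1 - e) * c <= F q -> [/\ 0 < `|q| & 1 - e <= F (`|q|^-1 *: q)].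
  move=> dF c0 qc Fq; have [_ FZ Fle] := dF.
  have q0 : 0 < `|q|.
    by apply: lt_le_trans (Fle q); apply: lt_le_trans Fq; exact: mulr_gt0.
  split=> //; rewrite FZ mulrC ler_pdivlMr //.
  by apply: le_trans Fq; rewrite ler_wpM2l // ltW.
have [p0 fp'] := normalize f p a df a0 pa fp.
have [_ gp'] := normalize g p a dg a0 pa gp.
have [w0 fw'] := normalize f w b df b0 wb fw.
have Ngw : (1 - e) * b <= g (- w) by rewrite dual_ballN //; lra.
have [] := normalize g (- w) b dg b0 _ Ngw; rewrite normrN // scalerN => _ gw'.
have nu (q : V) : 0 < `|q| -> `| `|q|^-1 *: q | = 1.
  by move=> q0; rewrite normrZ normfV normr_id mulVf // gt_eqF.
apply: le_trans (james_constant_ge (nu p p0) (nu w w0)).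
rewrite le_min; apply/andP; split.
  have [fD _ fle] := df; apply: le_trans (fle _); rewrite fD; lra.
have [gD _ gle] := dg; apply: le_trans (gle _); rewrite gD; lra.
Qed.

(** As [y] has weak limit 0, the bound on the mutual distances also bounds the
    [`|y i|], so that [c] is an upper bound for [`|p + y i|]; nonsquareness
    improves it by a fixed factor.  If it did not, take [f i] norming [p + y i],
    so that [f i] almost norms both [p] and [y i], and let [g] be the limit of the
    [f i].  For a suitable [i] and then a suitable [j], [f j (y i)] is small since
    it is close to [g (y i)], and [f i (y j)] is small since [y] is weakly null.
    Hence [f j] and [f i] take values close to [t * c] and [- (t * c)] at
    [y j - y i], and both almost norm [p]. *)
Lemma uniformly_nonsquare_weakly_null (t : R) : uniformly_nonsquare V ->
  0 < t < 1 -> exists2 k : R, 0 < k &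
  forall (I : Type) (U : set_system I) (y : I -> V) p (c : R),
    UltraFilter U -> 0 < c -> weak_cvg U y 0 -> `|p| <= (1 - t) * c ->
    (\forall i \near U, \forall j \near U, `|y i - y j| <= t * c) ->
    ~ (\forall i \near U, (1 - k) * c <= `|p + y i|).
Proof.
rewrite /uniformly_nonsquare; set J := james_constant V => J2 /andP[t0 t1].
(* The first bound gives [2 * (1 - e) > J], the second [e < 1]. *)
pose e := Num.min ((2 - J) / 4) 2^-1.
have e0 : 0 < e by rewrite lt_min; apply/andP; split; lra.
have eJ : e <= (2 - J) / 4 by rewrite ge_min lexx.
have e1 : e <= 2^-1 by rewrite ge_min lexx orbT.
pose m := Num.min t (1 - t).
have m0 : 0 < m by rewrite lt_min t0 subr_gt0.
have mt : m <= t by rewrite ge_min lexx.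
have mt' : m <= 1 - t by rewrite ge_min lexx orbT.
exists (e * m / 2); first by rewrite divr_gt0 // mulr_gt0.
move=> I U y p c UU c0 y0 pc yy pyc.
have /choice[f fP] i : exists F : V -> R, dual_ball F /\ F (p + y i) = `|p + y i|.
  by have [F dF Fx] := exists_norming (p + y i); exists F.
have df i : dual_ball (f i) by have [] := fP i.
have [g dg fg] := dual_ball_ultralimit (U := U) df.
pose h := e * m * c / 2.
have h0 : 0 < h by rewrite divr_gt0 // !mulr_gt0.
have null F : dual_ball F -> \forall i \near U, F (y i) < h.
  move=> dF; apply: (cvgr_lt _ (y0 F dF)).
  by rewrite -(subrr 0) dual_ballB // subrr.
have ytc : \forall i \near U, `|y i| <= t * c.
  apply: filterS yy => i yi; rewrite -normrN -sub0r.
  by apply: (weak_cvg_norm_le y0); apply: filterS yi => j; rewrite distrC.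
have [i [[[yi gi] pyi] yij]] :=
  filter_ex (filterI (filterI (filterI ytc (null g dg)) pyc) yy).
have fji : \forall j \near U, f j (y i) < h by exact: cvgr_lt (fg (y i)) _ gi.
have [j [[[[yj pyj] yjji] fiyj] fjyi]] :=
  filter_ex (filterI (filterI (filterI (filterI ytc pyc) yij) (null _ (df i))) fji).
have [fiD _ fil] := df i; have [fjD _ fjl] := df j.
have := proj2 (fP i); rewrite fiD => fi; have := proj2 (fP j); rewrite fjD => fj.
have hk : (1 - e * m / 2) * c = c - h by rewrite /h; ring.
move: yi gi yj fiyj fjyi pyi pyj; rewrite /= hk => yi gi yj fiyj fjyi pyi pyj.
have fii := fil (y i); have fjj := fjl (y j).
have fip := fil p; have fjp := fjl p.
have het : 2 * h <= e * (t * c).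
  by rewrite /h mulrA; have := ler_wpM2l (ltW (mulr_gt0 e0 c0)) mt; lra.
have het' : 2 * h <= e * ((1 - t) * c).
  by rewrite /h mulrA; have := ler_wpM2l (ltW (mulr_gt0 e0 c0)) mt'; lra.
have fjw : f j (y j - y i) = f j (y j) - f j (y i) by exact: dual_ballB.
have fiw : f i (y j - y i) = f i (y j) - f i (y i) by exact: dual_ballB.
have : 2 * (1 - e) <= J.
  apply: (@james_constant_functionals (f j) (f i) p (y j - y i)
    ((1 - t) * c) (t * c)) => //; rewrite ?fjw ?fiw.
  - by rewrite mulr_gt0 // subr_gt0.
  - by rewrite mulr_gt0.
  - by lra.
  - by rewrite distrC.
  - by lra.
  - by lra.
  - by lra.
  - by lra.
by lra.
Qed.

End Nonsquare.

(** * Asymptotic regularity of averaged maps *)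

Section AsymptoticRegularity.
Context {R : realType} {V : normedModType R}.
Implicit Types (x y u v : V) (g : R) (z w : nat -> V) (T : V -> V) (K : set V).

Lemma convex_combB g x y u :
  (1 - g) *: x + g *: y - u = (1 - g) *: (x - u) + g *: (y - u).
Proof.
by rewrite !scalerBr [RHS]addrACA -opprD -scalerDl subrK scale1r.
Qed.

Lemma bernoulli g n : 0 < g < 1 -> 1 + n%:R * g <= (1 - g)^-1 ^+ n.
Proof.
move=> /andP[g0 g1]; elim: n => [|n IH]; first by rewrite mul0r addr0 expr0.
rewrite exprSr ler_pdivlMr ?subr_gt0 //; apply: le_trans IH.
rewrite -natr1; have : 0 <= n%:R * g * g by rewrite !mulr_ge0 // ltW.
by nra.
Qed.

Lemma ishikawa_decr g z w k : 0 < g < 1 ->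
  (forall k, z k.+1 = (1 - g) *: z k + g *: w k) ->
  (forall k, `|w k.+1 - w k| <= `|z k.+1 - z k|) ->
  `|w k.+1 - z k.+1| <= `|w k - z k|.
Proof.
move=> /andP[g0 g1] zS wS.
have zB : z k.+1 - z k = g *: (w k - z k).
  by rewrite zS convex_combB subrr scaler0 add0r.
have -> : w k.+1 - z k.+1 = w k.+1 - w k + (1 - g) *: (w k - z k).
  rewrite -[w k.+1 - z k.+1](subrKA (w k)); congr (_ + _).
  rewrite -opprB zS convex_combB subrr scaler0 addr0 -scalerN opprB //.
apply: le_trans (ler_normD _ _) _.
apply: le_trans (lerD (wS k) (lexx _)) _.
have g1' : 0 < 1 - g by rewrite subr_gt0.
rewrite zB !normrZ (gtr0_norm g0) (gtr0_norm g1').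
by rewrite -mulrDl subrKC mul1r.
Qed.

Lemma ishikawa_mono g z w i n : 0 < g < 1 ->
  (forall k, z k.+1 = (1 - g) *: z k + g *: w k) ->
  (forall k, `|w k.+1 - w k| <= `|z k.+1 - z k|) ->
  `|w (i + n)%N - z (i + n)%N| <= `|w i - z i|.
Proof.
move=> g01 zS wS; elim: n => [|n IH]; first by rewrite addn0.
by rewrite addnS; apply: le_trans IH; exact: ishikawa_decr zS wS.
Qed.

(** Ishikawa's inequality.  When the displacement hardly decreases over [n] steps,
    the increments of [z] add up almost as if they were parallel, so [w (i + n)]
    is about [n * g] displacements away from [z i]. *)
Lemma ishikawa g z w n i : 0 < g < 1 ->
  (forall k, z k.+1 = (1 - g) *: z k + g *: w k) ->
  (forall k, `|w k.+1 - w k| <= `|z k.+1 - z k|) ->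
  (1 + n%:R * g) * `|w i - z i| <=
  `|w (i + n)%N - z i| +
    (1 - g)^-1 ^+ n * (`|w i - z i| - `|w (i + n)%N - z (i + n)%N|).
Proof.
move=> g01 zS wS; have /andP[g0 g1] := g01.
have g1' : 0 < 1 - g by rewrite subr_gt0.
have decr k := ishikawa_decr k g01 zS wS.
have zB k : `|z k.+1 - z k| = g * `|w k - z k|.
  by rewrite zS convex_combB subrr scaler0 add0r normrZ gtr0_norm.
elim: n i => [|n IH] i.
  by rewrite addn0 mul0r addr0 mul1r expr0 subrr mulr0 addr0.
have wB m : `|w (i + m)%N - w i| <= g * m%:R * `|w i - z i|.
  elim: m => [|m IHm]; first by rewrite addn0 subrr normr0 mulr0 mul0r.
  have := wS (i + m)%N; rewrite zB -addnS => step.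
  have := ler_distD (w (i + m)%N) (w (i + m.+1)%N) (w i).
  have := ler_wpM2l (ltW g0) (ishikawa_mono i m g01 zS wS).
  rewrite -natr1; lra.
have := IH i.+1; rewrite addSnnS.
set N := (i + n.+1)%N; set q := (1 - g)^-1 ^+ n.
set a := `|w i - z i|; set a' := `|w i.+1 - z i.+1|; set b := `|w N - z N|.
move=> IHi; have a'a : a' <= a by exact: decr.
have dist : `|w N - z i.+1| <= (1 - g) * `|w N - z i| + g * (g * n.+1%:R * a).
  rewrite distrC zS convex_combB; apply: le_trans (ler_normD _ _) _.
  rewrite !normrZ (gtr0_norm g0) (gtr0_norm g1') [`|z i - _|]distrC.
  by rewrite [`|w i - _|]distrC lerD2l ler_pM2l //; exact: wB.
rewrite exprS -/q -(ler_pM2l g1') mulrDr -mulrA mulVKf ?gt_eqF //.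
(* After multiplication by [1 - g], the two sides of the claim differ by at least
   [(q - (1 + n * g)) * (a - a')], which Bernoulli's inequality makes nonnegative. *)
have := mulr_ge0 (_ : 0 <= q - (1 + n%:R * g)) (_ : 0 <= a - a').
rewrite !subr_ge0 bernoulli // => /(_ isT a'a).
by move: dist IHi; rewrite -natr1; lra.
Qed.

Definition averaged g T x := (1 - g) *: x + g *: T x.

Definition convex_closed K := forall x y g,
  0 <= g <= 1 -> K x -> K y -> K ((1 - g) *: x + g *: y).

Lemma averaged_iter g T K k x : convex_closed K -> 0 < g < 1 ->
  (forall x, K x -> K (T x)) -> K x -> K (iter k (averaged g T) x).
Proof.
move=> Kc /andP[g0 g1] TK Kx; elim: k => //= k IH.
by apply: Kc => //; [rewrite !ltW|exact: TK].
Qed.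

(** Condition (C_lambda) holds between consecutive points of an orbit of the map
    averaged with the same parameter, since such points are exactly [g] times the
    displacement apart.  By Ishikawa's inequality with [(1 + n * g) * e >= d + 1],
    as long as the displacement exceeds [e] it loses every [n] steps an amount that
    does not depend on the starting point; hence one number of steps works for all
    of them. *)
Lemma averaged_asymptotically_regular g T K (d e : R) :
  convex_closed K -> 0 < g < 1 -> (forall x, K x -> K (T x)) ->
  condition_Clambda g K T -> (forall x y, K x -> K y -> `|x - y| <= d) ->
  0 < e -> exists k, forall x, K x ->
    `|iter k (averaged g T) x - T (iter k (averaged g T) x)| <= e.
Proof.
move=> Kc g01 TK Tg Kd e0; have /andP[g0 g1] := g01.
have ge0 : 0 < g * e by rewrite mulr_gt0.
have [n _ /(_ n (leqnn n)) /= nP] := nbhs_infty_ger ((d + 1) / (g * e)).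
have {}nP : d + 1 <= (1 + n%:R * g) * e.
  by move: nP; rewrite ler_pdivrMr //; nra.
pose q := (1 - g)^-1 ^+ n.
have q0 : 0 < q by rewrite exprn_gt0 // invr_gt0 subr_gt0.
have [m _ /(_ m (leqnn m)) /= mP] := nbhs_infty_ger (d * q).
exists (m * n)%N => x Kx.
pose z k := iter k (averaged g T) x; pose w k := T (z k).
have Kz k : K (z k) by exact: averaged_iter.
have zS k : z k.+1 = (1 - g) *: z k + g *: w k by [].
have wS k : `|w k.+1 - w k| <= `|z k.+1 - z k|.
  rewrite distrC [leRHS]distrC; apply: Tg => //.
  rewrite [leRHS]distrC zS convex_combB subrr scaler0 add0r normrZ gtr0_norm //.
  by rewrite distrC.
suff : `|w (m * n)%N - z (m * n)%N| <= e \/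
    `|w (m * n)%N - z (m * n)%N| <= d - m%:R * q^-1.
  move=> small; rewrite distrC; case: small => small; first exact: small.
  have dm : d - m%:R / q <= 0 by rewrite subr_le0 ler_pdivlMr.
  exact: le_trans small (le_trans dm (ltW e0)).
elim: (m) => [|j [IH|IH]].
- by right; rewrite mul0n mul0r subr0; apply: Kd => //; exact: TK.
- by left; apply: le_trans IH; rewrite mulSn addnC; exact: ishikawa_mono zS wS.
have := ishikawa n (j * n)%N g01 zS wS.
rewrite mulSn [(n + _)%N]addnC -/q.
set a := `|w (j * n)%N - _|; set a' := `|w (_ + _)%N - z (_ + _)%N|.
set b := `|_ - z (j * n)%N| => ish.
have [ae|ea] := leP a e.
  by left; apply: le_trans ae; exact: ishikawa_mono zS wS.
right; have bd : b <= d by apply: Kd => //; exact: TK.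
have : 1 <= q * (a - a').
  have : (1 + n%:R * g) * e <= (1 + n%:R * g) * a.
    have ng : 0 <= 1 + n%:R * g by rewrite addr_ge0 // mulr_ge0 // ltW.
    exact: ler_wpM2l ng _ _ (ltW ea).
  lra.
rewrite mulrC -ler_pdivrMr // div1r -natr1; move: IH; rewrite -/a; lra.
Qed.

End AsymptoticRegularity.

(** * Minimal invariant sets and the Goebel-Karlovitz lemma *)

Section MinimalSets.
Context {R : realType} {V : normedModType R}.
Implicit Types (x y u v : V) (C K : set V) (T : V -> V) (U : set_system V).

Lemma weak_cvg_unique (I : Type) (U : set_system I) (z : I -> V) u v :
  UltraFilter U -> weak_cvg U z u -> weak_cvg U z v -> u = v.
Proof.
move=> UU zu zv; apply/eqP; rewrite -subr_eq0 -normr_eq0.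
have [f df <-] := exists_norming (u - v).
by rewrite dual_ballB // subr_eq0; apply/eqP/(cvg_unique _ (zu f df) (zv f df)).
Qed.

(** Weak closedness expressed through ultrafilters of points of the set, the form
    in which it passes to intersections of chains. *)
Definition weakly_ultraclosed K := forall U u,
  UltraFilter U -> U K -> weak_cvg U id u -> K u.

Definition invariant_convex C T K :=
  [/\ K `<=` C, K !=set0, convex_closed K, weakly_ultraclosed K &
      forall x, K x -> K (T x)].

Lemma weakly_compact_ultraclosed C : weakly_compact C -> weakly_ultraclosed C.
Proof.
move=> Cc U u UU UC Uu.
have [v Cv Uv] := weakly_compact_ultra (z := id) Cc UU UC.
by rewrite (weak_cvg_unique UU Uu Uv).
Qed.

(** Zorn's lemma is applied to the complements in [C], which turns intersections of
    chains into unions; an ultrafilter containing all members of a chain has, by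
    weak compactness, a weak limit, and it lies in every member. *)
Lemma minimal_invariant_convex C T : weakly_compact C -> C !=set0 ->
  convex_closed C -> (forall x, C x -> C (T x)) ->
  exists2 K, invariant_convex C T K &
    forall L, invariant_convex C T L -> L `<=` K -> L = K.
Proof.
move=> Cc C0 Cconv TC.
have invC : invariant_convex C T C.
  by split=> //; exact: weakly_compact_ultraclosed.
have [F FP Ftot|A [PA Amax]] :=
    @Zorn_bigcup _ [set A | invariant_convex C T (C `\` A)].
  have [->|/set0P[A0 FA0]] := eqVneq F set0.
    by rewrite /= bigcup_set0 setD0.
  have PF : ProperFilter (filter_from F (fun A => C `\` A)).
    apply: filter_from_proper; last by move=> A /FP[].
    apply: filter_from_filter; first by exists A0.
    move=> A B FA FB; have [AB|BA] := Ftot _ _ FA FB.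
      by exists B => // x [Cx nBx]; split; split=> // /AB.
    by exists A => // x [Cx nAx]; split; split=> // /BA.
  have [U [UU FU]] := ultraFilterLemma PF.
  have UCA A : F A -> U (C `\` A) by move=> FA; apply: FU; exists A.
  have UC : U C by apply: filterS (UCA _ FA0) => x [].
  have [u Cu Uu] := weakly_compact_ultra (z := id) Cc UU UC.
  split=> /=.
  - by move=> x [].
  - exists u; split=> // -[A FA Au].
    have [_ _ _ Acl _] := FP _ FA.
    by have [] := Acl U u UU (UCA _ FA) Uu.
  - move=> x y g g01 [Cx nx] [Cy ny]; split; first exact: Cconv.
    move=> [A FA]; have [_ _ Acv _ _] := FP _ FA.
    have [//|//|_] := Acv x y g g01.
    + by split=> // Ax; apply: nx; exists A.
    + by split=> // Ay; apply: ny; exists A.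
    + exact.
  - move=> W v WW WCF Wv; split.
      apply: (weakly_compact_ultraclosed Cc WW _ Wv).
      by apply: filterS WCF => x [].
    move=> [A FA]; have [_ _ _ Acl _] := FP _ FA.
    have [|_] := Acl W v WW _ Wv; last exact.
    by apply: filterS WCF => x [Cx nx]; split=> // Ax; apply: nx; exists A.
  - move=> x [Cx nx]; split; first exact: TC.
    move=> [A FA]; have [_ _ _ _ TA] := FP _ FA.
    have [|_] := TA x; last exact.
    by split=> // Ax; apply: nx; exists A.
exists (C `\` A) => // L invL LK; apply: contrapT => LnK.
have LC : L `<=` C by case: invL.
have CL : C `\` ~` L = L by rewrite setDE setCK; exact/setIidPr.
apply: (Amax (~` L)); last by rewrite /= CL.
split.
  by move=> x Ax Lx; have [] := LK _ Lx.
move=> LA; apply: LnK; apply/seteqP; split=> // x [Cx nAx].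
by apply: contrapT => nLx; exact/nAx/LA.
Qed.

(** The displacement [x - T x] is closed at 0: the only consequence of condition
    (C), or of continuity, that is used besides condition (C_lambda). *)
Definition closed_displacement C T := forall u, C u ->
  (forall e : R, 0 < e -> exists x, [/\ C x, `|x - u| <= e & `|x - T x| <= e]) ->
  T u = u.

Definition approx_fixed T K U := [/\ UltraFilter U, U K &
  forall e : R, 0 < e -> \forall x \near U, `|x - T x| <= e].

Lemma exists_approx_fixed T K :
  (forall e : R, 0 < e -> exists2 x, K x & `|x - T x| <= e) ->
  exists U, approx_fixed T K U.
Proof.
move=> KT.
have /choice[x xP] (n : nat) : exists x, K x /\ `|x - T x| <= n.+1%:R^-1 :> R.
  by have [|x Kx xT] := KT n.+1%:R^-1; [rewrite invr_gt0|exists x].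
have [U0 [UU0 U0oo]] := ultraFilterLemma eventually_filter.
exists (x @ U0); split; first exact: fmap_ultra.
  suff : \forall n \near U0, K (x n) by [].
  by apply: filterE => n; have [] := xP n.
move=> e e0; suff : \forall n \near U0, `|x n - T (x n)| <= e by [].
apply: U0oo.
have [m _ mP] := nbhs_infty_ger e^-1; exists m => // n /= mn.
apply: le_trans (proj2 (xP n)) _; rewrite invf_ple ?posrE //.
by apply: le_trans (mP _ mn) _; rewrite ler_nat.
Qed.

(** The convex function [r v = lim `|x - v|] is weakly lower semicontinuous: the
    limit along [U] of functionals norming [x - u] is, up to sign, a subgradient
    of [r] at [u]. *)
Lemma weak_cvg_norm_cvg_le U u (r : V -> R) (c : R) W : UltraFilter U ->
  (forall v, `|x - v| @[x --> U] --> r v) ->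
  UltraFilter W -> weak_cvg W id u -> (\forall v \near W, r v <= c) -> r u <= c.
Proof.
move=> UU Ur WW Wu Wc.
have /choice[f fP] x : exists F : V -> R, dual_ball F /\ F (x - u) = `|x - u|.
  by have [F dF Fx] := exists_norming (x - u); exists F.
have df x : dual_ball (f x) by have [] := fP x.
have [g dg fg] := dual_ball_ultralimit (U := U) df.
have subgrad v : r u + (g u - g v) <= r v.
  rewrite -dual_ballB //.
  have h : `|x - v| - (`|x - u| + f x (u - v)) @[x --> U]
      --> r v - (r u + g (u - v)).
    by apply: cvgB => //; apply: cvgD.
  rewrite -subr_ge0; apply: (cvgr_to_ge h); near=> x.
  have [fD _ fle] := df x; rewrite -(proj2 (fP x)) -fD subr_ge0.
  by rewrite addrA subrK.
have h : c - (g u - g v) @[v --> W] --> c - (g u - g u).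
  apply: cvgB; first exact: cvg_cst.
  by apply: cvgB; [exact: cvg_cst|exact: Wu].
have := cvgr_to_ge h; rewrite subrr subr0; apply; near=> v.
rewrite lerBrDr; apply: le_trans (subgrad v) _; near: v; exact: Wc.
Unshelve. all: by end_near. Qed.

(** The limit distance [r u] from the approximate fixed points does not increase
    under [T].  If [r u > 0], the points [x] are eventually farther from [u] than
    their displacement, so condition (C_lambda) applies to [x] and [u]; if
    [r u = 0], then [u] is fixed.  Therefore the sublevel sets of [r] in [K] are
    invariant, and minimality leaves no room for two different values. *)
Lemma approx_fixed_radius C K T (l M : R) U :
  0 < l < 1 -> (forall x, C x -> `|x| <= M) -> condition_Clambda l C T ->
  closed_displacement C T -> invariant_convex C T K ->
  (forall L, invariant_convex C T L -> L `<=` K -> L = K) ->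
  approx_fixed T K U ->
  exists c : R, forall u, K u -> `|x - u| @[x --> U] --> c.
Proof.
move=> l1 CM Tl Tcl invK Kmin [UU UK UT]; have [KC [u0 Ku0] Kcv Kcl TK] := invK.
have /choice[r Ur] v : exists c : R, `|x - v| @[x --> U] --> c.
  apply: (@ultra_bounded_cvg _ _ _ _ _ (M + `|v|)).
  apply: filterS UK => x /KC/CM xM; rewrite normr_id.
  by apply: le_trans (ler_normB _ _) _; rewrite lerD2r.
have r0 v : 0 <= r v by apply: (cvgr_to_ge (Ur v)); near=> x; exact: normr_ge0.
have rT u : K u -> r (T u) <= r u.
  move=> Ku; have [ru|ru] := leP (r u) 0.
    suff -> : T u = u by [].
    apply: Tcl; [exact: KC|move=> e e0].
    have h1 : \forall x \near U, `|x - u| <= e.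
      by apply: (cvgr_le _ (Ur u)); exact: le_lt_trans e0.
    have [x [[xu xT] Kx]] := filter_ex (filterI (filterI h1 (UT e e0)) UK).
    by exists x; split=> //; exact: KC.
  apply/ler_addgt0Pr => e e0; apply: (cvgr_to_le (Ur (T u))).
  have h1 : \forall x \near U, `|x - u| <= r u + e / 2.
    by apply: (cvgr_le _ (Ur u)); rewrite ltrDl divr_gt0.
  have h2 : \forall x \near U, r u / 2 <= `|x - u|.
    by apply: (cvgr_ge _ (Ur u)); rewrite ltr_pdivrMr //; lra.
  have e2 : 0 < e / 2 by rewrite divr_gt0.
  have r2 : 0 < r u / 2 by rewrite divr_gt0.
  near=> x.
  have Kx : K x by near: x.
  have xT : `|x - T x| <= e / 2 by near: x; exact: UT.
  have xT' : `|x - T x| <= r u / 2 by near: x; exact: UT.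
  have xu : `|x - u| <= r u + e / 2 by near: x.
  have ux : r u / 2 <= `|x - u| by near: x.
  have : `|T x - T u| <= `|x - u|.
    apply: Tl; [exact: KC|exact: KC|]; apply: le_trans ux; apply: le_trans xT'.
    by rewrite ler_piMl // ltW //; have /andP[] := l1.
  have := ler_distD (T x) x (T u); lra.
have rle u v : K u -> K v -> r u <= r v.
  move=> Ku Kv; pose L := [set u | K u /\ r u <= r v].
  suff KL : L = K by have [] : L u by rewrite KL.
  apply: Kmin; last by move=> x [].
  split.
  - by move=> x [/KC].
  - by exists v.
  - move=> x y g g01 [Kx rx] [Ky ry]; split; first exact: Kcv.
    have /andP[g0 g1] := g01.
    have h : (1 - g) * `|w - x| + g * `|w - y| @[w --> U]
        --> (1 - g) * r x + g * r y.
      by apply: cvgD; apply: cvgM => //; exact: cvg_cst.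
    have rv : (1 - g) * r x + g * r y <= r v.
      have := ler_wpM2l g0 ry; have := ler_wpM2l (_ : 0 <= 1 - g) rx.
      rewrite subr_ge0 => /(_ g1); lra.
    apply: le_trans rv; rewrite -subr_ge0.
    apply: (cvgr_to_ge (cvgB h (Ur _))); near=> w.
    rewrite subr_ge0 distrC convex_combB; apply: le_trans (ler_normD _ _) _.
    by rewrite !normrZ ger0_norm ?subr_ge0 // (ger0_norm g0)
      [`|x - w|]distrC [`|y - w|]distrC.
  - move=> W u' WW WL Wu'; split.
      by apply: Kcl Wu' => //; apply: filterS WL => x [].
    apply: (weak_cvg_norm_cvg_le UU Ur WW Wu').
    by apply: filterS WL => x [].
  - by move=> x [Kx rx]; split; [exact: TK|apply: le_trans rx; exact: rT].
exists (r u0) => u Ku; suff <- : r u = r u0 by [].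
by apply/eqP; rewrite eq_le !rle.
Unshelve. all: by end_near. Qed.

End MinimalSets.

(** * Fixed points *)

Section FixedPoint.
Context {R : realType} {V : normedModType R}.
Implicit Types (x y u v : V) (C K : set V) (T : V -> V) (U : set_system V).

Lemma averagedB (g : R) T u v :
  averaged g T u - averaged g T v = (1 - g) *: (u - v) + g *: (T u - T v).
Proof. by rewrite /averaged opprD addrACA -!scalerBr. Qed.

Lemma weak_cvgB (I : Type) (U : set_system I) (y z : I -> V) u v :
  UltraFilter U -> weak_cvg U y u -> weak_cvg U z v ->
  weak_cvg U (fun i => y i - z i) (u - v).
Proof.
move=> UU yu zv f df; rewrite dual_ballB //.
rewrite (_ : (fun i => f (y i - z i)) = (fun i => f (y i) - f (z i))).
  by apply: cvgB; [exact: yu|exact: zv].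
by apply/funext => i; rewrite dual_ballB.
Qed.

Lemma weak_cvg_cst (I : Type) (U : set_system I) v :
  UltraFilter U -> weak_cvg U (fun=> v) v.
Proof. by move=> UU f df; exact: cvg_cst. Qed.

(** The weight [t = 4 / 5] must be such that the displacement of these points,
    at most [2 * (1 - t)] times the radius, stays below their mutual distance, at
    least [2 * t - 1] times the radius; this requires [t > 3 / 4]. *)
Definition shifted_orbit (l : R) T v k x :=
  iter k (averaged l T) ((1 - 4 / 5) *: v + (4 / 5) *: x).

(** Both estimates hold initially and survive one step of the averaged map, because
    the pairs to which [T] is applied satisfy the premise of condition
    (C_lambda).  For [x] and its image: the image cannot be close to [x], since the
    mutual distances of the images, at most [4 / 5 * c] in the limit, would
    then be as large as those of the points, which are [c].  For two images: their
    distance exceeds their displacements. *)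
Lemma shifted_orbit_estimates C K T U (l c : R) v k :
  K `<=` C -> convex_closed K -> (forall x, K x -> K (T x)) ->
  0 < l < 1 -> condition_Clambda l C T ->
  approx_fixed T K U -> 0 < c ->
  (forall u, K u -> `|x - u| @[x --> U] --> c) -> K v ->
  (forall e : R, 0 < e ->
    \forall x \near U, `|shifted_orbit l T v k x - x| <= c / 5 + e) /\
  (forall e : R, 0 < e -> \forall x \near U, \forall y \near U,
    `|shifted_orbit l T v k x - shifted_orbit l T v k y| <= 4 / 5 * c + e).
Proof.
move=> KC Kcv TK l01 Tl [UU UK UT] c0 Uc Kv; have /andP[l0 l1] := l01.
have Unear u e : K u -> 0 < e -> \forall x \near U, c - e <= `|x - u| <= c + e.
  move=> Ku e0.
  have h1 : \forall x \near U, c - e <= `|x - u|.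
    by apply: (cvgr_ge _ (Uc u Ku)); rewrite ltrBlDr ltrDl.
  have h2 : \forall x \near U, `|x - u| <= c + e.
    by apply: (cvgr_le _ (Uc u Ku)); rewrite ltrDl.
  by near=> x; apply/andP; split; near: x.
have Kz j x : K x -> K (shifted_orbit l T v j x).
  move=> Kx; apply: averaged_iter => //.
  by apply: Kcv => //; apply/andP; split; lra.
elim: k => [|k [IHA IHB]].
  split=> e e0.
    apply: filterS (Unear v e Kv e0) => x /andP[_ xv].
    rewrite /shifted_orbit /= convex_combB subrr scaler0 addr0 normrZ.
    by rewrite [`|v - x|]distrC ger0_norm; lra.
  apply: filterS UK => x Kx; apply: filterS (Unear x e Kx e0) => y /andP[_ yx].
  rewrite /shifted_orbit /= opprD addrACA subrr add0r -scalerBr normrZ.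
  by rewrite [`|x - y|]distrC ger0_norm; lra.
pose z := shifted_orbit l T v k.
rewrite -/z in IHA IHB.
have zS x : shifted_orbit l T v k.+1 x = averaged l T (z x) by [].
have c100 : 0 < c / 100 by rewrite divr_gt0.
(* The constant 1/20 is below half of [1 - 4 / 5], with room for the errors
   [c / 100]. *)
have zfar : \forall x \near U, c / 20 <= `|x - z x|.
  have [] := in_ultra_setVsetC [set x | c / 20 <= `|x - z x|] UU => // zclose.
  exfalso; have [x [[xz xx] Kx]] :=
    filter_ex (filterI (filterI zclose (IHB _ c100)) UK).
  have [y [[yz xy] yx]] :=
    filter_ex (filterI (filterI zclose xx) (Unear x _ Kx c100)).
  move: xz yz xy yx; rewrite /= => /negP + /negP + + /andP[+ _].
  rewrite -!ltNge => xz yz xy yx.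
  have := ler_distD (z y) y x; have := ler_distD (z x) (z y) x.
  rewrite [`|z y - z x|]distrC [`|z x - x|]distrC; lra.
have Tz : \forall x \near U, `|T x - T (z x)| <= `|x - z x|.
  have h := UT (c / 20) (divr_gt0 c0 _).
  near=> x; have Kx : K x by near: x.
  apply: Tl; [exact: KC|exact/KC/Kz|].
  apply: le_trans (_ : c / 20 <= _); last by near: x.
  apply: le_trans (_ : `|x - T x| <= _); last by near: x; exact: h.
  by rewrite ler_piMl // ltW.
split=> e e0.
  have e2 : 0 < e / 2 by rewrite divr_gt0.
  near=> x; rewrite zS /averaged convex_combB.
  have zx : `|z x - x| <= c / 5 + e / 2 by near: x; exact: IHA.
  have xT : `|x - T x| <= e / 2 by near: x; exact: UT.
  have TT : `|T x - T (z x)| <= `|x - z x| by near: x.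
  have Tzx := ler_distD (T x) (T (z x)) x.
  apply: le_trans (ler_normD _ _) _.
  rewrite !normrZ (gtr0_norm l0) gtr0_norm ?subr_gt0 //.
  move: Tzx; rewrite [`|T (z x) - T x|]distrC [`|T x - x|]distrC.
  move: TT; rewrite [`|x - z x|]distrC => TT Tzx.
  have := ler_wpM2l (ltW l0) Tzx; have := ler_wpM2l (ltW l0) TT.
  have := ler_wpM2l (ltW l0) xT; nra.
have bound : \forall x \near U, [/\ K x, `|z x - x| <= c / 5 + c / 100,
    `|x - T x| <= c / 100 & `|T x - T (z x)| <= `|x - z x| ].
  near=> x; split; near: x => //; [exact: IHA|exact: UT].
near=> x.
have [Kx zx xT xTz] : [/\ K x, `|z x - x| <= c / 5 + c / 100,
    `|x - T x| <= c / 100 & `|T x - T (z x)| <= `|x - z x| ] by near: x.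
have xy := Unear x _ Kx c100.
have zz : \forall y \near U, `|z x - z y| <= 4 / 5 * c + e.
  by near: x; exact: IHB.
near=> y.
have [Ky zy _ _] : [/\ K y, `|z y - y| <= c / 5 + c / 100,
    `|y - T y| <= c / 100 & `|T y - T (z y)| <= `|y - z y| ] by near: y.
have /andP[yx _] : c - c / 100 <= `|y - x| <= c + c / 100 by near: y.
have zxy : `|z x - z y| <= 4 / 5 * c + e by near: y.
have : `|T (z x) - T (z y)| <= `|z x - z y|.
  apply: Tl; [exact/KC/Kz|exact/KC/Kz|].
  apply: le_trans (_ : `|z x - T (z x)| <= _).
    by rewrite ler_piMl // ltW.
  have := ler_distD x (z x) (T (z x)); have := ler_distD (T x) x (T (z x)).
  have := ler_distD (z y) y x; have := ler_distD (z x) (z y) x.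
  move: zx zy; rewrite [`|z y - z x|]distrC [`|z y - y|]distrC.
  by move: xTz; rewrite [`|x - z x|]distrC; lra.
move=> TT; rewrite !zS averagedB; apply: le_trans (ler_normD _ _) _.
rewrite !normrZ (gtr0_norm l0) gtr0_norm ?subr_gt0 //.
have := ler_wpM2l (ltW l0) TT; nra.
Unshelve. all: by end_near. Qed.

(** The minimal-set argument described at the top.  An approximate fixed
    point near [x0] would produce a radius smaller than the infimum [c0], so the
    almost fixed points [z x] are almost [c0] away from [x0]. *)
Lemma condition_Clambda_fixed_point C T (l : R) : weakly_compact C -> C !=set0 ->
  convex_closed C -> uniformly_nonsquare V -> (forall x, C x -> C (T x)) ->
  0 < l < 1 -> condition_Clambda l C T ->
  closed_displacement C T -> exists2 x, C x & T x = x.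
Proof.
move=> Cc C0 Ccv V2 TC l01 Tl Tcl; apply: contrapT => nofix.
have [M CM] := weakly_compact_bounded Cc.
have [K invK Kmin] := minimal_invariant_convex Cc C0 Ccv TC.
have [KC [u0 Ku0] Kcv Kcl TK] := invK.
have TKl : condition_Clambda l K T.
  by move=> x y Kx Ky; apply: Tl; exact: KC.
have Kd x y : K x -> K y -> `|x - y| <= M + M.
  move=> /KC/CM xM /KC/CM yM; apply: le_trans (ler_normB _ _) _.
  exact: lerD.
have reg e := averaged_asymptotically_regular Kcv l01 TK TKl Kd (e := e).
have radius U := approx_fixed_radius (U := U) l01 CM Tl Tcl invK Kmin.
pose S : set R := [set c : R | exists2 U, approx_fixed T K U &
  forall u, K u -> `|x - u| @[x --> U] --> c].
have S0 : S !=set0.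
  have [|U UT] := @exists_approx_fixed _ _ T K.
    move=> e /reg[k kP]; exists (iter k (averaged l T) u0); last exact: kP.
    exact: averaged_iter.
  by have [c Uc] := radius U UT; exists c, U.
pose d := `|u0 - T u0| / 2.
have d0 : 0 < d.
  rewrite divr_gt0 // normr_gt0 subr_eq0; apply/eqP => u0T.
  by apply: nofix; exists u0; [exact: KC|exact/esym].
have Sd c : S c -> d <= c.
  move=> [U [UU UK UT] Uc].
  have h : `|x - u0| + `|x - T u0| @[x --> U] --> c + c.
    by apply: cvgD; apply: Uc => //; exact: TK.
  rewrite /d ler_pdivrMr // mulr_natr mulr2n.
  apply: (cvgr_to_ge h); near=> x.
  by have := ler_distD x u0 (T u0); rewrite [`|u0 - x|]distrC.
pose c0 := inf S.
have Slb : has_lbound S by exists d => c /Sd.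
have c0d : d <= c0 by apply: lb_le_inf => // c /Sd.
have c00 : 0 < c0 by exact: lt_le_trans c0d.
have c0S c : S c -> c0 <= c by move=> Sc; exact: ge_inf.
have t01 : 0 < (4 / 5 : R) < 1 by apply/andP; split; lra.
have [k k0 kP] := uniformly_nonsquare_weakly_null V2 t01.
pose h := k * c0; have h0 : 0 < h by exact: mulr_gt0.
have h4 : 0 < h / 4 by rewrite divr_gt0.
have [c Sc cc0] := inf_adherent h4 (conj S0 Slb).
have c0c := c0S c Sc; have [U [UU UK UT] Uc] := Sc.
have [x0 Cx0 Ux0] := weakly_compact_ultra (z := id) Cc UU (filterS KC UK).
have Kx0 : K x0 by exact: Kcl Ux0.
have [e e0 eP] : exists2 e : R, 0 < e &
    forall z, K z -> `|z - T z| <= e -> c0 - h / 4 <= `|z - x0|.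
  apply: contrapT => ne.
  have [|W [WW WK WT]] :=
      @exists_approx_fixed _ _ T (K `&` [set z | `|z - x0| < c0 - h / 4]).
    move=> e e0; apply: contrapT => nz; apply: ne; exists e => // z Kz zT.
    by rewrite leNgt; apply/negP => zx0; apply: nz; exists z.
  have WTK : approx_fixed T K W.
    by split=> //; apply: filterS WK => z [].
  have [c1 Wc1] := radius W WTK.
  have : c0 <= c1 by apply: c0S; exists W.
  have : c1 <= c0 - h / 4.
    by apply: (cvgr_to_le (Wc1 x0 Kx0)); apply: filterS WK => z [_ /ltW].
  by lra.
have [j jP] := reg e e0.
pose z := shifted_orbit l T x0 j.
have Kz x : K x -> K (z x).
  move=> Kx; apply: averaged_iter => //.
  by apply: Kcv => //; apply/andP; split; lra.
have [zx zz] := shifted_orbit_estimates j KC Kcv TK l01 Tl (And3 UU UK UT)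
  (lt_le_trans c00 c0c) Uc Kx0.
have [z0 _ Uz0] := weakly_compact_ultra (z := z) Cc UU
  (filterS (fun x Kx => KC _ (Kz x Kx)) UK).
have h20 : 0 < h / 20 by rewrite divr_gt0.
(* The radius [c0 + h / 2] leaves room for the excess [c - c0 < h / 4] and for the
   errors [h / 20], and [k] times it still exceeds the loss in the lower bound. *)
apply: (kP V U (fun x => z x - z0) (z0 - x0) (c0 + h / 2)) => //.
- by rewrite addr_gt0 // divr_gt0.
- by rewrite -(subrr z0); apply: weak_cvgB => //; exact: weak_cvg_cst.
- rewrite -[z0 - x0]subr0; apply: (weak_cvg_norm_le (weak_cvgB UU Uz0 Ux0)).
  apply: filterS (zx _ h20) => x zxx; rewrite subr0.
  by apply: le_trans zxx _; lra.
- apply: filterS (zz _ h20) => x; apply: filterS => y zxy.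
  by rewrite opprB addrA subrK; apply: le_trans zxy _; lra.
- apply: filterS UK => x Kx; rewrite [z0 - x0 + _]addrC addrA subrK.
  have zT : `|z x - T (z x)| <= e.
    by apply: jP; apply: Kcv => //; apply/andP; split; lra.
  apply: le_trans (eP _ (Kz x Kx) zT).
  by have := mulr_ge0 (ltW k0) (ltW h0); have := h0; rewrite /h; lra.
Unshelve. all: by end_near. Qed.

End FixedPoint.

(** * Limits of approximate fixed points are fixed *)

Section Closedness.
Context {R : realType} {V : normedModType R}.
Implicit Types (C : set V) (T : V -> V).

(** Suzuki's inequality.  If condition (C) does not apply to [x] and [u], then [u]
    is closer to [x] than half the displacement, hence far enough from [T x] for
    the condition to apply to [T x] and [u]. *)
Lemma condition_C_displacement C T x u : (forall x, C x -> C (T x)) ->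
  condition_C C T -> C x -> C u ->
  `|x - T u| <= 3 * `|x - T x| + `|x - u|.
Proof.
move=> TC T2 Cx Cu; have x0 := normr_ge0 (x - T x).
have [near_u|far_u] := leP (2^-1 * `|x - T x|) `|x - u|.
  have := T2 x u Cx Cu near_u; have := ler_distD (T x) x (T u); lra.
have TT : `|T x - T (T x)| <= `|x - T x|.
  by apply: T2 => //; [exact: TC|lra].
have : `|T (T x) - T u| <= `|T x - u|.
  apply: T2 => //; [exact: TC|have := ler_distD u x (T x)].
  rewrite [`|u - T x|]distrC; lra.
have := ler_distD (T x) x (T u); have := ler_distD (T (T x)) (T x) (T u).
have := ler_distD x (T x) u; rewrite [`|T x - x|]distrC; lra.
Qed.

Lemma condition_C_closed C T : (forall x, C x -> C (T x)) ->
  condition_C C T -> closed_displacement C T.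
Proof.
move=> TC T2 u Cu uT; apply/eqP; rewrite -subr_eq0 -normr_le0.
apply/ler_addgt0Pr => e e0; rewrite add0r.
have e5 : 0 < e / 5 by rewrite divr_gt0.
have [x [Cx xu xT]] := uT _ e5.
have := condition_C_displacement TC T2 Cx Cu.
have := ler_distD x (T u) u; rewrite [`|T u - x|]distrC; lra.
Qed.

Lemma within_continuous_closed C T : {within C, continuous T} ->
  closed_displacement C T.
Proof.
move=> Tcont u Cu uT; apply/eqP; rewrite -subr_eq0 -normr_le0.
apply/ler_addgt0Pr => e e0; rewrite add0r.
have e3 : 0 < e / 3 by rewrite divr_gt0.
have /cvgrPdist_le/(_ _ e3) := (subspace_continuousP _ T).1 Tcont u Cu.
rewrite near_withinE => /nbhs_normP[d /= d0 dP].
have m0 : 0 < Num.min (d / 2) (e / 3) by rewrite lt_min e3 divr_gt0.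
have [x [Cx xu xT]] := uT _ m0.
move: xu xT; rewrite !le_min => /andP[xd xe] /andP[_ xT].
have /dP/(_ Cx) TT : ball_ Num.norm u d x by rewrite /= distrC; lra.
have := ler_distD (T x) (T u) u; have := ler_distD x (T x) u.
rewrite [`|T x - x|]distrC; lra.
Qed.

End Closedness.

Theorem corollary4p7 (R : realType) (X : completeNormedModType R) (C : set X)
    (C_nonempty : C !=set0)
    (C_convex : convex_set (C : set (convex_lmodType X)))
    (C_weakly_compact : weakly_compact C)
    (X_nonsquare : uniformly_nonsquare X) :
  (forall T : X -> X,
     set_fun C C T ->
     condition_C C T ->
     exists2 x, C x & T x = x) /\
  (forall (T : X -> X) (lambda : R),
     set_fun C C T ->
     {within C, continuous T} ->
     0 < lambda < 1 ->
     condition_Clambda lambda C T ->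
     exists2 x, C x & T x = x).
Proof.
have Ccv : convex_closed C.
  move=> x y g /andP[g0 g1] Cx Cy.
  have := C_convex y x (Itv01 g0 g1) (mem_set Cy) (mem_set Cx).
  by rewrite inE addrC.
split=> [T TC T2|T l TC Tcont l01 Tl].
  have h01 : 0 < (2^-1 : R) < 1 by apply/andP; split; lra.
  apply: (condition_Clambda_fixed_point C_weakly_compact C_nonempty Ccv X_nonsquare
    TC h01 T2).
  exact: condition_C_closed.
apply: (condition_Clambda_fixed_point C_weakly_compact C_nonempty Ccv X_nonsquare
  TC l01 Tl).
exact: within_continuous_closed.
Qed.
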